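(* Let $G$ be a countable discrete FC-group and let $m\in\mathbb{N}$, $m\geq 1$, be arbitrary. For any finite partition $G^m=\bigcup_{j=1}^{r}C_j$, there exists $1\leq j\leq r$ such that the set of all $g\in G$ for which there exists $(x_1,x_2,\ldots,x_m)\in G^m$ with $$\{(x_1,x_2,\ldots,x_m),(x_1g,x_2,\ldots,x_m),(x_1g,x_2g,x_3,\ldots,x_m),\ldots,(x_1g,x_2g,\ldots,x_mg)\}\subseteq C_j$$ is left IP$^{\ast}$.
   Context: An FC-group is a group all of whose conjugacy classes are finite. $G^m$ is the direct product of $m$ copies of $G$. For a sequence $(x_n)_{n\in\mathbb{N}}$ in a group $G$, the left finite product set is $\mathbf{FP}_L(x_n)=\{x_{n_k}x_{n_{k-1}}\cdots x_{n_1} : k\geq 1,\ n_1<n_2<\dots<n_k\}$ (products over finite nonempty index sets, with indices taken in decreasing order). A set $Y\subseteq G$ is a left IP set if it contains $\mathbf{FP}_L(x_n)$ for some sequence $(x_n)_{n\in\mathbb{N}}$ in $G$. A set $X\subseteq G$ is left IP$^{\ast}$ if $X\cap Y\neq\emptyset$ for every left IP set $Y\subseteq G$. *)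

(* Defs.v *)
From HB Require Import structures.
From mathcomp Require Import all_boot.
From mathcomp Require Import boolp classical_sets functions cardinality.

Set Implicit Arguments.
Unset Strict Implicit.
Unset Printing Implicit Defensive.

Local Open Scope classical_set_scope.
Local Open Scope group_scope.

Definition FC_group (G : groupType) : Prop :=
  forall x : G, finite_set [set x ^ y | y in [set: G]].

(* A finite nonempty index set n_1 < ... < n_k is encoded by the strictly
   increasing sequence [:: n_1; ...; n_k]; since rev s is decreasing, the
   product is x_{n_k} * ... * x_{n_1}. *)
Definition FP_L (G : groupType) (x : nat -> G) : set G :=
  [set \prod_(n <- rev s) x n | s in [set s : seq nat | s <> [::] /\ sorted ltn s]].

Definition left_IP (G : groupType) (Y : set G) : Prop :=
  exists x : nat -> G, FP_L x `<=` Y.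

Definition left_IPstar (G : groupType) (X : set G) : Prop :=
  forall Y : set G, left_IP Y -> X `&` Y !=set0.

(* (x_1 g, ..., x_k g, x_{k+1}, ..., x_m). The coordinates are numbered from 0,
   so the first k of them are those with i < k. *)
Definition rmul_first (G : groupType) (m : nat) (g : G) (x : {ffun 'I_m -> G})
    (k : nat) : {ffun 'I_m -> G} :=
  [ffun i : 'I_m => if i < k then x i * g else x i].

(* Main.v *)
Require Import Defs.
From HB Require Import structures.
From mathcomp Require Import all_boot.
From mathcomp Require Import boolp classical_sets functions cardinality.

(* If every colour [j] were bad, it would have a sequence [x_j] with [FP_L x_j]
   disjoint from its return set. Since centralizers in an FC-group have finite
   index, products of the [x_j] over suitable intervals of indices commute, so
   there are commuting elements [y_(j,n)], with [y_(j,0), y_(j,1), ...] a block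
   subsystem of [x_j]. Send a word [w] over the alphabet [{0..m}^r] to the point
   of [G^m] whose [i]-th coordinate is the product of the [y_(j,n)] such that
   [w_n(j) > i]. Hales-Jewett yields a monochromatic combinatorial line; once its
   colour [c] is known, letting only the [c]-th component of the variable run
   over [0..m] gives a configuration of colour [c] whose [g], the product of
   [y_(c,n)] over the variable positions, lies in [FP_L x_c]. *)

Local Open Scope classical_set_scope.
Local Open Scope group_scope.

Section HalesJewett.
Context {A : finType}.

(* A combinatorial line is a variable word, [None] standing for the variable. *)
Definition subst (v : seq (option A)) (a : A) : seq A := map (odflt a) v.

Lemma subst_cat u v a : subst (u ++ v) a = subst u a ++ subst v a.
Proof. exact: map_cat. Qed.

Lemma subst_const w a : subst (map Some w) a = w.
Proof. by rewrite /subst -map_comp map_id. Qed.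

(** Only the letters substituted for the variable are confined to [s]; the fixed letters range over
    all of [A], so one type serves the whole induction on the alphabet. *)
Definition mono_line {K : Type} (c : seq A -> K) (s : seq A) N v :=
  [/\ size v = N, None \in v & {in s &, forall a b, c (subst v a) = c (subst v b)}].

(** The colour set is quantified inside because the induction on the alphabet uses the hypothesis
    for the larger set of functions from suffixes to colours. *)
Definition HJ_on (s : seq A) := forall K : finType,
  exists N, forall c : seq A -> K, exists v, mono_line c s N v.

(* With [t = #|K| + 1] the lines in the second alternative would have more
   colours than there are, which leaves the first one. *)
Lemma focusing (a b : A) (s : seq A) (K : finType) : HJ_on (b :: s) -> forall t,
  exists N, forall c : seq A -> K,
    (exists v, mono_line c (a :: b :: s) N v) \/
    exists w (vs : seq (seq (option A))),
      [/\ size w = N, size vs = t, uniq [seq c (subst v b) | v <- vs]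
        & forall v, v \in vs -> mono_line c (b :: s) N v /\ subst v a = w].
Proof.
move=> HJs; elim=> [|t [N IH]].
  by exists 0 => c; right; exists [::], [::].
have [M HM] := HJs {ffun N.-tuple A -> K}.
exists (M + N)%N => c.
(* A prefix [u] is coloured by the colouring it induces on the suffixes [y]. *)
have [u [szu uN uc]] := HM (fun u => [ffun y : N.-tuple A => c (u ++ y)]).
have {}uc x y : x \in b :: s -> size y = N ->
    c (subst u x ++ y) = c (subst u b ++ y).
  move=> xs /eqP szy.
  have := uc x b xs (mem_head _ _) => /ffunP/(_ (Tuple szy)).
  by rewrite !ffunE.
have szub : size (subst u b) = M by rewrite size_map.
have lift_line s' v : mono_line (fun y => c (subst u b ++ y)) s' N v ->
    mono_line c s' (M + N) (map Some (subst u b) ++ v).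
  case=> szv vN vc; split; first by rewrite size_cat size_map szub szv.
    by rewrite mem_cat vN orbT.
  by move=> x y xs ys; rewrite !subst_cat !subst_const; exact: vc.
have [[v /lift_line v_mono]|[w [vs [szw szvs vs_uniq vsP]]]] :=
  IH (fun y => c (subst u b ++ y)); first by left; eexists; exact: v_mono.
(* All lines in [vs] pass through [w] at the letter [a]. A line already having the colour of this
   focus stays monochromatic at [a]; otherwise that colour is new and [u ++ map Some w] joins the
   family. *)
have [/mapP[v v_vs cw]|cw] :=
  boolP (c (subst u b ++ w) \in [seq c (subst u b ++ subst v b) | v <- vs]).
  left; exists (map Some (subst u b) ++ v); apply: lift_line.
  have [[szv vN vc] va] := vsP v v_vs; split=> //.
  suff E x : x \in a :: b :: s ->
      c (subst u b ++ subst v x) = c (subst u b ++ subst v b).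
    by move=> x y /E-> /E->.
  rewrite in_cons => /predU1P[->|xs]; first by rewrite va.
  exact: vc xs (mem_head _ _).
right; exists (subst u a ++ w), ((u ++ map Some w) :: [seq u ++ v | v <- vs]).
split; first by rewrite size_cat size_map szu szw.
- by rewrite /= size_map szvs.
- rewrite /= -map_comp subst_cat subst_const.
  rewrite (eq_map (g := fun v => c (subst u b ++ subst v b))) ?cw //.
  by move=> v /=; rewrite subst_cat.
- move=> v; rewrite in_cons => /predU1P[->|/mapP[{}v v_vs ->]].
    rewrite subst_cat subst_const; split=> //; split.
    + by rewrite size_cat size_map szu szw.
    + by rewrite mem_cat uN.
    + by move=> x y xs ys; rewrite !subst_cat !subst_const !uc.
  have [[szv vN vc] va] := vsP v v_vs.
  rewrite subst_cat va; split=> //; split.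
  + by rewrite size_cat szu szv.
  + by rewrite mem_cat uN.
  + by move=> x y xs ys; rewrite !subst_cat !uc ?size_map //; exact: vc.
Qed.

Lemma HJ_on_seq (s : seq A) : HJ_on s.
Proof.
elim: s => [|a [|b s] IH] K.
- by exists 1%N => c; exists [:: None].
- exists 1%N => c; exists [:: None]; split=> // x y.
  by rewrite !inE => /eqP-> /eqP->.
have [N HN] := focusing a b s K IH #|K|.+1.
exists N => c; have [//|[w [vs [_ szvs vs_uniq _]]]] := HN c.
have := uniq_leq_size vs_uniq (fun x _ => mem_enum K x).
by rewrite size_map szvs -cardE ltnn.
Qed.

Lemma hales_jewett (K : finType) : exists N, forall c : seq A -> K,
  exists v : seq (option A), [/\ size v = N, None \in v
    & forall a b, c (subst v a) = c (subst v b)].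
Proof.
have [N HN] := HJ_on_seq (enum A) K; exists N => c.
have [v [szv vN vc]] := HN c; exists v; split=> // a b.
by apply: vc; rewrite mem_enum.
Qed.

End HalesJewett.

(** Each [h] has finitely many conjugates, so the list of conjugates of [L] by [p n] takes finitely
    many values: pigeonhole on [n]. *)
Lemma FC_conj_collision (G : groupType) (p : nat -> G) (L : seq G) :
  FC_group G ->
  exists n1 n2, (n1 < n2)%N /\ {in L, forall h, h ^ p n1 = h ^ p n2}.
Proof.
move=> G_FC; pose f n := [seq h ^ p n | h <- L].
have f_fin : finite_set (f @` [set: nat]).
  rewrite {}/f; elim: L => [|h L IH].
    apply: (@sub_finite_set _ _ [set [::]]); last exact: finite_set1.
    by move=> _ [n _ <-].
  apply: sub_finite_set (finite_image (fun q => q.1 :: q.2)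
    (finite_setX (G_FC h) IH)).
  move=> _ [n _ <-]; exists (h ^ p n, [seq h ^ p n | h <- L]) => //=.
  by split; [exists (p n) | exists n].
have [f_inj|] := pselect (injective f).
  case: infinite_nat; rewrite -(preimage_range f).
  by apply: finite_preimage => // x y _ _; exact: f_inj.
move=> f_ninj; apply: contrapT => nocoll; apply: f_ninj => n1 n2 f12.
have coll a b : f a = f b -> {in L, forall h, h ^ p a = h ^ p b} by move/eq_in_map.
have [n12|n21|//] := ltngtP n1 n2; case: nocoll.
  by exists n1, n2; split=> //; exact: coll.
by exists n2, n1; split=> //; exact: coll.
Qed.

(** If two products [p n1] and [p n2] over initial segments starting at [M] conjugate [L] alike,
    then [p n2 * (p n1)^-1] centralizes [L]; the decreasing order makes it the product over the
    interval between them. *)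
Lemma FC_commuting_block (G : groupType) (x : nat -> G) (L : seq G) (M : nat) :
  FC_group G ->
  exists b, [/\ b <> [::], sorted ltn b, {in b, forall p, (M <= p)%N}
    & {in L, forall h, commute (\prod_(l <- rev b) x l) h}].
Proof.
move=> G_FC; pose p n := \prod_(l <- rev (iota M n)) x l.
have [n1 [n2 [n12 eqp]]] := FC_conj_collision G p L G_FC.
exists (iota (M + n1) (n2 - n1)); split.
- by move/(congr1 size); rewrite size_iota => /eqP; rewrite subn_eq0 leqNgt n12.
- exact: iota_ltn_sorted.
- by move=> q; rewrite mem_iota => /andP[+ _]; apply: leq_trans; exact: leq_addr.
move=> h /eqp; set y := bigop _ _ _.
have -> : p n2 = y * p n1.
  by rewrite /p -{1}(subnKC (ltnW n12)) iotaD rev_cat big_cat.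
by rewrite conjgM => /conjg_inj/esym/conjg_fixP/commgP/commute_sym.
Qed.

Lemma FC_commuting_blocks (G : groupType) (X : nat -> nat -> G) (T : nat) :
  FC_group G ->
  exists b : nat -> seq nat,
  let y t := \prod_(l <- rev (b t)) X t l in
  [/\ forall t, (t < T)%N -> b t <> [::] /\ sorted ltn (b t),
      forall s t, (s < t < T)%N -> {in b s & b t, forall p q, (p < q)%N}
    & forall s t, (s < T)%N -> (t < T)%N -> commute (y s) (y t)].
Proof.
move=> G_FC; elim: T => [|T [b [b_sorted b_incr b_comm]]].
  by exists (fun=> [::]); split=> // s t; rewrite ltn0 andbF.
pose y t := \prod_(l <- rev (b t)) X t l.
(* The new block starts past every index used so far. *)
have [b' [b'0 b'_sorted b'_ge b'_comm]] := FC_commuting_block G (X T)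
  [seq y t | t <- iota 0 T] (\max_(p <- flatten [seq b t | t <- iota 0 T]) p).+1
  G_FC.
have {}b'_comm t : (t < T)%N -> commute (\prod_(l <- rev b') X T l) (y t).
  by move=> tT; apply/b'_comm/map_f; rewrite mem_iota.
have {}b'_ge t p q : (t < T)%N -> p \in b t -> q \in b' -> (p < q)%N.
  move=> tT pb /b'_ge; apply: leq_ltn_trans.
  apply: (@leq_bigmax_seq _ _ xpredT (fun p => p) p) => //.
  by apply/flatten_mapP; exists t; rewrite ?mem_iota.
exists (fun t => if (t < T)%N then b t else b') => /=; split.
- by move=> t _; case: ifP => // /b_sorted.
- move=> s t /andP[st]; rewrite ltnS leq_eqVlt => /predU1P[tT|tT].
    subst t; rewrite st ltnn => p q ps qt.
    exact: (b'_ge s).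
  by rewrite tT (ltn_trans st tT); apply: (b_incr s t); rewrite st.
- move=> s t; rewrite !ltnS (leq_eqVlt s) (leq_eqVlt t) => /predU1P[->|sT]
    /predU1P[->|tT].
  + exact: commute_refl.
  + by rewrite ltnn tT; exact: b'_comm.
  + by rewrite ltnn sT; apply/commute_sym; exact: b'_comm.
  + by rewrite sT tT; exact: b_comm.
Qed.

Lemma sorted_ltn_flatten (ss : seq (seq nat)) :
  all (sorted ltn) ss -> pairwise (allrel ltn) ss -> sorted ltn (flatten ss).
Proof.
rewrite sorted_pairwise; last exact: ltn_trans.
elim: ss => //= s ss IH /andP[ss_sorted sss] /andP[s_ss ssp].
rewrite pairwise_cat IH // andbT -sorted_pairwise ?ss_sorted ?andbT; last first.
  exact: ltn_trans.
apply/allrelP => p q ps /flattenP[t tss qt].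
by have /allrelP := allP s_ss t tss; apply.
Qed.

(** The index sequence is the concatenation of the blocks selected by [P], nonempty thanks to [n0];
    reversing it reverses both the order of the blocks and each block. *)
Lemma FP_L_blocks (G : groupType) (x : nat -> G) (N : nat)
    (b : 'I_N -> seq nat) (P : pred 'I_N) (n0 : 'I_N) : P n0 ->
  (forall n, b n <> [::] /\ sorted ltn (b n)) ->
  (forall n n' : 'I_N, (n < n')%N -> {in b n & b n', forall p q, (p < q)%N}) ->
  FP_L x (\prod_(n <- rev (enum 'I_N) | P n) \prod_(l <- rev (b n)) x l).
Proof.
move=> Pn0 b_sorted b_incr.
exists (flatten [seq b n | n <- enum 'I_N & P n]); last first.
  by rewrite rev_flatten big_flatten -map_rev -map_rev big_map big_map
    -filter_rev big_filter.
split.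
  have [] := b_sorted n0; case Eb: (b n0) => [//|p s] _ _ E.
  have : p \in flatten [seq b n | n <- enum 'I_N & P n].
    apply/flatten_mapP; exists n0; first by rewrite mem_filter Pn0 mem_enum.
    by rewrite Eb mem_head.
  by rewrite E.
apply: sorted_ltn_flatten.
  by apply/allP => _ /mapP[n _ ->]; have [] := b_sorted n.
rewrite pairwise_map; apply: pairwise_filter.
have : pairwise (relpre val ltn) (enum 'I_N).
  rewrite -pairwise_map val_enum_ord -sorted_pairwise; last exact: ltn_trans.
  exact: iota_ltn_sorted.
apply: sub_pairwise => n n' nn'; apply/allrelP => p q; exact: b_incr nn' _ _.
Qed.

Lemma FC_config (G : groupType) (m r : nat) (x : 'I_r -> nat -> G)
    (c : {ffun 'I_m -> G} -> 'I_r) : FC_group G ->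
  exists (j : 'I_r) (g : G) (z : {ffun 'I_m -> G}),
    FP_L (x j) g /\ forall k, (k <= m)%N -> c (rmul_first g z k) = j.
Proof.
(* Without colours there is no [c], since [G^m] has a point. *)
move=> G_FC; case: r => [|r] in x c *; first by case: (c [ffun=> 1]).
have [N HJN] := hales_jewett (A := {ffun 'I_r.+1 -> 'I_m.+1}) 'I_r.+1.
(* Block [t] uses the sequence of colour [t %% r.+1]: each colour gets [N] blocks, interleaved in
   one increasing chain. *)
have [b [b_sorted b_incr y_comm]] :=
  FC_commuting_blocks G (fun t => x (inord (t %% r.+1))) (N * r.+1) G_FC.
pose ix (j : 'I_r.+1) (n : 'I_N) := (n * r.+1 + j)%N.
have ix_lt j n : (ix j n < N * r.+1)%N.
  apply: (@leq_trans (n.+1 * r.+1)); last by rewrite leq_mul2r ltn_ord orbT.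
  by rewrite mulSnr ltn_add2l.
have ix_col j n : inord (ix j n %% r.+1) = j.
  by rewrite modnMDl modn_small ?inord_val.
pose y j n := \prod_(l <- rev (b (ix j n))) x j l.
have {}y_comm j n j' n' : commute (y j n) (y j' n').
  by have := y_comm _ _ (ix_lt j n) (ix_lt j' n'); rewrite !ix_col.
pose a0 : {ffun 'I_r.+1 -> 'I_m.+1} := [ffun=> ord0].
pose val_at (i : 'I_m) (a : {ffun 'I_r.+1 -> 'I_m.+1}) n :=
  \prod_(j < r.+1 | (i < a j)%N) y j n.
pose F w : {ffun 'I_m -> G} :=
  [ffun i => \prod_(n <- rev (enum 'I_N)) val_at i (nth a0 w n) n].
have [v [szv vN vc]] := HJN (fun w => c (F w)).
pose j := c (F (subst v a0)).
pose g := \prod_(n <- rev (enum 'I_N) | nth None v n == None) y j n.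
exists j, g, (F (subst v a0)); split.
  have iN : (index None v < N)%N by rewrite -szv index_mem.
  apply: (@FP_L_blocks _ _ _ _ _ (Ordinal iN)).
  - by rewrite /= nth_index.
  - by move=> n; exact: b_sorted.
  - move=> n n' nn'; apply: b_incr; rewrite ix_lt andbT /ix.
    apply: (@leq_trans (n.+1 * r.+1)); first by rewrite mulSnr ltn_add2l.
    by rewrite (leq_trans _ (leq_addr _ _)) // leq_mul2r nn' orbT.
move=> k km; pose ak : {ffun 'I_r.+1 -> 'I_m.+1} :=
  [ffun j' => if j' == j then inord k else ord0].
rewrite [RHS](vc a0 ak); congr c; apply/ffunP => i; rewrite !ffunE.
have nth_subst a (n : 'I_N) : nth a0 (subst v a) n = odflt a (nth None v n).
  by rewrite (nth_map None) // szv.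
have val_a0 n : val_at i a0 n = 1.
  by apply: big1 => j'; rewrite ffunE.
have val_ak n : val_at i ak n = if (i < k)%N then y j n else 1.
  rewrite /val_at (eq_bigl (fun j' => (j' == j) && (i < k)%N)); last first.
    by move=> j'; rewrite ffunE; case: eqP; rewrite // inordK.
  case: ifP => _; last by rewrite big_pred0 // => j'; rewrite andbF.
  by under eq_bigl do rewrite andbT; rewrite big_pred1_eq.
(* Fixed positions do not see the change from [a0] to [ak]; a variable position gains [y j n] in the
   coordinates below [k] only. *)
have split_at (n : 'I_N) : val_at i (nth a0 (subst v ak) n) n =
    val_at i (nth a0 (subst v a0) n) n *
    (if (i < k)%N && (nth None v n == None) then y j n else 1).
  rewrite !nth_subst; case: (nth None v n) => [a|] /=.
    by rewrite andbF mulg1.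
  by rewrite andbT val_a0 val_ak mul1g.
(* By commutativity the gained factors move to the right, where they form [g]. *)
rewrite [RHS](eq_bigr _ (fun n _ => split_at n)) prodgM_commute.
  case: (i < k)%N => /=; first by rewrite -big_mkcond.
  by rewrite big1_eq mulg1.
move=> n n' _ _; case: ifP => _; last exact: commute1.
by apply/commute_sym/commute_prod => j' _; exact: y_comm.
Qed.

Theorem theorem2 (G : groupType) (G_countable : countable [set: G])
    (G_FC : FC_group G) (m : nat) (m_ge1 : (1 <= m)%N) (r : nat)
    (C : 'I_r -> set {ffun 'I_m -> G})
    (C_cover : \bigcup_(j in [set: 'I_r]) C j = [set: {ffun 'I_m -> G}])
    (C_disjoint : trivIset [set: 'I_r] C) :
  exists j : 'I_r,
    left_IPstar [set g : G | exists x : {ffun 'I_m -> G},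
      [set rmul_first g x k | k in [set k : nat | (k <= m)%N]] `<=` C j].
Proof.
have [c cC] : {c : {ffun 'I_m -> G} -> 'I_r & forall z, C (c z) z}.
  apply: (@choice _ _ (fun z j => C j z)) => z; have : [set: {ffun 'I_m -> G}] z by [].
  by rewrite -C_cover => -[j _ Cjz]; exists j.
apply: contrapT => /forallNP no_j.
have [x xP] : {x : 'I_r -> nat -> G & forall j g, FP_L (x j) g ->
    ~ exists z, [set rmul_first g z k | k in [set k | (k <= m)%N]] `<=` C j}.
  (* If every sequence had a finite product in the return set of [j], that set would be left IP*,
     against [no_j]. *)
  apply: (@choice _ _ (fun j x => forall g, FP_L x g -> ~ exists z, _)) => j;
  apply: contrapT => /forallNP bad; case: (no_j j).
  move=> Y [x xY]; apply: contrapT => RY0; case: (bad x) => g /xY Yg Rg.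
  by case: RY0; exists g.
have [j [g [z [gx zj]]]] := FC_config G m r x c G_FC.
by case: (xP j g gx); exists z => _ [k km <-]; rewrite -(zj k km).
Qed.
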